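(* Let $\mathcal U\subset\mathbb C$ be a simply connected domain with coordinate $z=x+iy$, let $U:\mathcal U\to\mathbb R$ be a real-valued potential, and let $\psi=\begin{pmatrix}\psi_1\\ \psi_2\end{pmatrix}$ be a nowhere vanishing solution of the Dirac equation $\mathcal D\psi=0$ with potential $U$. Put $$\Psi_0=\begin{pmatrix}\psi_1&-\bar\psi_2\\ \psi_2&\bar\psi_1\end{pmatrix},$$ and let $S:\mathcal U\to su(2)\cong\mathbb R^3$ be the surface defined by $\psi$ via the Weierstrass representation, written in matrix form as $$S(P)= S(P_0)+i\int_{P_0}^P\left[\begin{pmatrix}\psi_1\bar\psi_2&-\bar\psi_2^2\\ \psi_1^2&-\psi_1\bar\psi_2\end{pmatrix}dz+\begin{pmatrix}\bar\psi_1\psi_2&\bar\psi_1^2\\ -\psi_2^2&-\bar\psi_1\psi_2\end{pmatrix}d\bar z\right],$$ where $P_0\in\mathcal U$ is fixed and $S(P_0)\in su(2)$ is a constant. Assume that $S$ does not pass through $0$. Let $\widetilde S=S^{-1}$ be the surface obtained from $S$ by the inversion $T$. Then $\widetilde S$ is defined via the Weierstrass representation by the spinor (first column) of $$\widetilde\Psi_0=\Psi_0S^{-1},$$ and $\widetilde\Psi_0$ satisfies the Dirac equation with the potential $\widetilde U$ given by (where $\widetilde U$ and $U$ on the two sides stand for the scalar matrices $\widetilde U\cdot I$ and $U\cdot I$) $$\widetilde U=U-i\left(\begin{pmatrix}0&1\\0&0\end{pmatrix}G\begin{pmatrix}1&0\\0&0\end{pmatrix}+\begin{pmatrix}0&0\\1&0\end{pmatrix}G\begin{pmatrix}0&0\\0&1\end{pmatrix}\right),\qquad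 G=\Psi_0S^{-1}\Gamma\Psi_0^\top .$$
   Context: All functions are smooth. Notation: $\partial=\frac12(\partial_x-i\partial_y)$, $\bar\partial=\frac12(\partial_x+i\partial_y)$, $\Gamma=\begin{pmatrix}0&1\\-1&0\end{pmatrix}$, and $X^\top$ is the (non-conjugated) transpose. Dirac operator with real-valued potential $U$: $\mathcal D=\begin{pmatrix}0&\partial\\-\bar\partial&0\end{pmatrix}+\begin{pmatrix}U&0\\0&U\end{pmatrix}$; the Dirac equation is $\mathcal D\psi=0$. For a $2\times2$ matrix-valued $\Psi$, ''$\mathcal D\Psi=0$'' means that each column satisfies the equation. If $\psi=(\psi_1,\psi_2)^\top$ is a solution, then so is $(-\bar\psi_2,\bar\psi_1)^\top$. Weierstrass representation: a solution $\psi$ of $\mathcal D\psi=0$ defines, up to translation, a surface $r=(x^1,x^2,x^3):\mathcal U\to\mathbb R^3$ by $$\partial x^1=\tfrac i2(\psi_1^2+\bar\psi_2^2),\quad \partial x^2=\tfrac12(\bar\psi_2^2-\psi_1^2),\quad \partial x^3=\psi_1\bar\psi_2 .$$ It is a conformal immersion where $\psi\ne0$, with induced metric $e^{2\alpha}dz\,d\bar z$, $e^\alpha=|\psi_1|^2+|\psi_2|^2$. A surface is said to be defined by the spinor $\psi$ via the Weierstrass representation if these formulas hold. Identification $\mathbb R^3\cong su(2)$: $\mathbf x=(x^1,x^2,x^3)\mapsto\mathbf X=\begin{pmatrix}ix^3&-x^1-ix^2\\ x^1-ix^2&-ix^3\end{pmatrix}$. The inversion is $T:\mathbf x\mapsto-\mathbf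 x/|\mathbf x|^2$, which in matrix form is $T(\mathbf X)=\mathbf X^{-1}$. *)

(* Defs.v *)
From HB Require Import structures.
From mathcomp Require Import all_boot all_order all_algebra.
From mathcomp Require Import complex.
From mathcomp Require Import all_classical all_reals all_analysis.

Set Implicit Arguments.
Unset Strict Implicit.
Unset Printing Implicit Defensive.

Import Order.TTheory GRing.Theory Num.Theory.
Import numFieldNormedType.Exports.

Local Open Scope classical_set_scope.
Local Open Scope ring_scope.
Local Open Scope complex_scope.

(* The complex plane, as the domain of functions, is R * R: the point
   z = x + iy is the pair (x, y).  Values of functions are in R[i]. *)

Section Domains.
Variable R : realType.

(* Every loop is contractible in D, with fixed base point.  Nonemptiness is
   not part of the definition. *)
Definition simply_connected_domain (D : set (R * R)) : Prop :=
  [/\ open D, connected D &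
    forall g : R -> R * R,
      {within `[0, 1], continuous g} -> (forall t, t \in `[0, 1] -> D (g t)) ->
      g 0 = g 1 ->
      exists H : R * R -> R * R,
        [/\ {within `[0, 1]%classic `*` `[0, 1]%classic, continuous H},
            forall s t, s \in `[0, 1] -> t \in `[0, 1] -> D (H (s, t)),
            forall t, t \in `[0, 1] -> H (0, t) = g t /\ H (1, t) = g 0 &
            forall s, s \in `[0, 1] -> H (s, 0) = g 0 /\ H (s, 1) = g 0]].

End Domains.

Section Smoothness.
Variable R : realType.
Implicit Types (D : set (R * R)) (p : R * R).

Definition e_x : R * R := (1, 0).
Definition e_y : R * R := (0, 1).

(* Meaningful for open D: the derivatives at a point of D only depend on the
   values of the function on D. *)
Fixpoint Ck D (k : nat) (u : R * R -> R) : Prop :=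
  (forall p, D p -> {for p, continuous u}) /\
  match k with
  | 0 => True
  | k'.+1 => [/\ forall p, D p -> derivable u p e_x /\ derivable u p e_y,
                 Ck D k' ('D_e_x u) & Ck D k' ('D_e_y u)]
  end.

Definition smooth D (u : R * R -> R) : Prop := forall k, Ck D k u.

Definition csmooth D (f : R * R -> R[i]) : Prop :=
  smooth D (fun p => complex.Re (f p)) /\ smooth D (fun p => complex.Im (f p)).

Definition mxsmooth D m n (F : R * R -> 'M[R[i]]_(m, n)) : Prop :=
  forall i j, csmooth D (fun p => F p i j).

Definition cderive (v : R * R) (f : R * R -> R[i]) p : R[i] :=
  'D_v (fun q => complex.Re (f q)) p +i* 'D_v (fun q => complex.Im (f q)) p.

Definition del (f : R * R -> R[i]) p : R[i] :=
  2^-1 * (cderive e_x f p - 'i%C * cderive e_y f p).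

Definition delbar (f : R * R -> R[i]) p : R[i] :=
  2^-1 * (cderive e_x f p + 'i%C * cderive e_y f p).

End Smoothness.

Section LineIntegrals.
Variable R : realType.
Implicit Types (D : set (R * R)) (P Q : R * R) (g : R -> R * R).

(* An arc is parametrized by [0, 1]; being C^1 up to the endpoints, it is
   given by a C^1 extension to the whole line. *)
Definition C1_arc D g : Prop :=
  [/\ forall t, derivable g t 1, continuous (derive1 g) &
      forall t, t \in `[0, 1] -> D (g t)].

(* Piecewise C^1 paths from P to Q in D, as lists of consecutive arcs. *)
Fixpoint contour D P Q (c : seq (R -> R * R)) : Prop :=
  match c with
  | [::] => P = Q
  | g :: c' => [/\ C1_arc D g, g 0 = P & contour D (g 1) Q c']
  end.

Definition cintegral01 (f : R -> R[i]) : R[i] :=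
  (\int[lebesgue_measure]_(t in `[0%R, 1%R]) complex.Re (f t)) +i*
  (\int[lebesgue_measure]_(t in `[0%R, 1%R]) complex.Im (f t)).

Definition velocity g (t : R) : R[i] := (derive1 g t).1 +i* (derive1 g t).2.

(* The integral of the 1-form A dz + B dzbar, entrywise. *)
Definition arc_integral m n (A B : R * R -> 'M[R[i]]_(m, n)) g :
    'M[R[i]]_(m, n) :=
  \matrix_(i, j) cintegral01 (fun t =>
    A (g t) i j * velocity g t + B (g t) i j * (velocity g t)^*%C).

Definition line_integral m n (A B : R * R -> 'M[R[i]]_(m, n))
    (c : seq (R -> R * R)) : 'M[R[i]]_(m, n) :=
  \sum_(g <- c) arc_integral A B g.

End LineIntegrals.

Section Spinors.
Variable R : realType.
Implicit Types (D : set (R * R)) (p : R * R).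

Definition mx2 (K : Type) (a b c d : K) : 'M[K]_2 :=
  \matrix_(i < 2, j < 2)
    if i == 0 then (if j == 0 then a else b) else (if j == 0 then c else d).

Definition Gamma : 'M[R[i]]_2 := mx2 0 1 (-1) 0.

(* The Dirac operator with potential U, acting on each column of Psi. *)
Definition dirac_op (U : R * R -> R) n (Psi : R * R -> 'M[R[i]]_(2, n)) p :
    'M[R[i]]_(2, n) :=
  \matrix_(i, j) (if i == 0 then del (fun q => Psi q 1 j) p
                  else - delbar (fun q => Psi q 0 j) p)
  + (U p)%:C *: Psi p.

Definition spinor_mx (v : 'cV[R[i]]_2) : 'M[R[i]]_2 :=
  mx2 (v 0 0) (- (v 1 0)^*%C)
      (v 1 0) (v 0 0)^*%C.

(* x^1, x^2, x^3 are the entries 0, 1, 2 of a row vector. *)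
Definition weierstrass D (psi : R * R -> 'cV[R[i]]_2)
    (r : R * R -> 'rV[R]_3) : Prop :=
  (forall k, smooth D (fun p => r p 0 k)) /\
  forall p, D p ->
    let psi1 := psi p 0 0 in
    let psi2 := psi p 1 0 in
    [/\ del (fun q => (r q 0 0)%:C) p = 'i%C / 2 * (psi1 ^+ 2 + psi2^*%C ^+ 2),
        del (fun q => (r q 0 1)%:C) p = 2^-1 * (psi2^*%C ^+ 2 - psi1 ^+ 2) &
        del (fun q => (r q 0 2)%:C) p = psi1 * psi2^*%C].

(* The identification of R^3 with su(2). *)
Definition su2mx (x : 'rV[R]_3) : 'M[R[i]]_2 :=
  mx2 ('i%C * (x 0 2)%:C)              (- (x 0 0)%:C - 'i%C * (x 0 1)%:C)
      ((x 0 0)%:C - 'i%C * (x 0 1)%:C) (- ('i%C * (x 0 2)%:C)).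

(* The norm here is Euclidean, unlike the library norm on row vectors. *)
Definition inversion (x : 'rV[R]_3) : 'rV[R]_3 :=
  - (\sum_k x 0 k ^+ 2)^-1 *: x.

(* The coefficients of dz and dzbar in -i dS. *)
Definition weierstrass_dz (v : 'cV[R[i]]_2) : 'M[R[i]]_2 :=
  let psi1 := v 0 0 in let psi2 := v 1 0 in
  mx2 (psi1 * psi2^*%C) (- psi2^*%C ^+ 2)
      (psi1 ^+ 2)     (- (psi1 * psi2^*%C)).

Definition weierstrass_dzbar (v : 'cV[R[i]]_2) : 'M[R[i]]_2 :=
  let psi1 := v 0 0 in let psi2 := v 1 0 in
  mx2 (psi1^*%C * psi2)  (psi1^*%C ^+ 2)
      (- psi2 ^+ 2)    (- (psi1^*%C * psi2)).

End Spinors.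

(* Main.v *)
Require Import Defs.
From HB Require Import structures.
From mathcomp Require Import all_boot all_order all_algebra.
From mathcomp Require Import complex ring lra.
From mathcomp Require Import all_classical all_reals all_analysis.

Set Implicit Arguments.
Unset Strict Implicit.
Unset Printing Implicit Defensive.

Import Order.TTheory GRing.Theory Num.Theory.
Import numFieldNormedType.Exports.

Local Open Scope classical_set_scope.
Local Open Scope ring_scope.
Local Open Scope complex_scope.

(** Write [W = Psi0 S^-1] for the transformed spinor matrix, [w0], [w1] for the
    rows of [Psi0] and [a], [b] for the entries of [psi], so that
    [w0 = (a, - conj b)] and [w1 = (b, conj a)].

    The integral formula says that [S] is a primitive of the matrix 1-form with
    coefficients [i weierstrass_dz] and [i weierstrass_dzbar].  The first has rank
    one: it is [- i Gamma w0^T w0].  Differentiating [S^-1] gives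
    [del (S^-1) = - S^-1 (del S) S^-1], and since [S] is traceless,
    [S^-1 Gamma = - Gamma (S^-1)^T]; hence
    [del (S^-1) = - i Gamma (w0 S^-1)^T (w0 S^-1)], which is the Weierstrass
    formula for the first row of [W].  As [S^-1] is, like [Psi0], of the form of
    a real quaternion, this first row comes from the spinor in the first column
    of [W] ([spinor_mx_su2mx]).  The computation is [weierstrass_inversion].

    The Dirac equation is then a Leibniz rule:
    [del (w1 S^-1) = - U w0 S^-1 - i w1 Gamma (w0 S^-1)^T (w0 S^-1)
                   = - (U - i G_10) (w0 S^-1)],
    where [G_10] is purely imaginary, so that the new potential is real
    ([dirac_potential]).  The second equation is similar, and the second column
    of [W] satisfies the same equations because it is the quaternionic conjugate
    of the first ([dirac_spinor_mx]).

    What precedes needs [S] to be smooth with the expected derivatives, whereas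
    the hypothesis only gives integrals along contours issued from [P0].  Every
    point of the domain is the end of a contour ([contour_exists]), so that the
    difference of the values of [S] at the ends of a segment is the integral
    along the segment.  The mean value estimate [primitive_estimate] then gives
    the partial derivatives, which are polynomials in [psi] and its conjugate,
    and smoothness follows ([smooth_of_derive], [weierstrass_of_integral]). *)

(** * Smooth functions on an open set *)

Section SmoothCalculus.
Context {R : realType} (D : set (R * R)).
Hypothesis oD : open D.
Implicit Types (u v : R * R -> R) (p : R * R) (k : nat).

Lemma near_eq_on u v p : {in D, u =1 v} -> D p -> \near p, u p = v p.
Proof.
move=> uv Dp; have := open_nbhs_nbhs (conj oD Dp).
by apply: filterS => q Dq; apply/uv/mem_set.
Qed.

Lemma continuous_eq_on u v p :
  {in D, u =1 v} -> D p -> {for p, continuous u} -> {for p, continuous v}.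
Proof.
move=> uv Dp cu; rewrite /prop_for /continuous_at -(uv _ (mem_set Dp)).
by apply: cvg_trans cu; apply: near_eq_cvg; exact: near_eq_on.
Qed.

Lemma derive_eq_on e u v : {in D, u =1 v} -> {in D, 'D_e u =1 'D_e v}.
Proof.
by move=> uv p /set_mem Dp; apply: near_eq_derive; exact: near_eq_on.
Qed.

(** Leibniz-type formulas for iterated derivatives only hold on [D], so the
    inductions below have to replace a derivative by a function that agrees with
    it there but possibly not elsewhere. *)
Lemma Ck_eq_on k u v : {in D, u =1 v} -> Ck D k u -> Ck D k v.
Proof.
elim: k u v => [|k IH] u v uv [cu].
  by move=> _; split => // p Dp; apply: continuous_eq_on (cu p Dp).
case=> du Du1 Du2; split=> [p Dp|]; first exact: continuous_eq_on (cu p Dp).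
split; [|exact: IH (derive_eq_on _ uv) Du1|exact: IH (derive_eq_on _ uv) Du2].
move=> p Dp; have [d1 d2] := du p Dp.
have nuv := near_eq_on uv Dp.
by split; [exact: near_eq_derivable nuv d1|exact: near_eq_derivable nuv d2].
Qed.

Lemma Ck_le k u : Ck D k.+1 u -> Ck D k u.
Proof.
elim: k u => [|k IH] u [cu [du D1 D2]]; first by split.
by split; [exact: cu|split; [exact: du|exact: IH D1|exact: IH D2]].
Qed.

Lemma Ck_cst k (c : R) : Ck D k (cst c).
Proof.
elim: k c => [|k IH] c; split => //; try by move=> p _; exact: cst_continuous.
split=> [p _| |]; first by split; exact: derivable_cst.
- rewrite (_ : 'D_(e_x R) _ = cst 0) //.
  by apply/funext => p; rewrite derive_cst.
- rewrite (_ : 'D_(e_y R) _ = cst 0) //.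
  by apply/funext => p; rewrite derive_cst.
Qed.

Lemma CkD k u v : Ck D k u -> Ck D k v -> Ck D k (u + v).
Proof.
elim: k u v => [|k IH] u v [cu +] [cv].
  by move=> _ _; split=> // p Dp; apply: continuousD; [exact: cu|exact: cv].
move=> [du ux uy] [dv vx vy]; split=> [p Dp|].
  by apply: continuousD; [exact: cu|exact: cv].
split=> [p Dp| |].
- have [u1 u2] := du p Dp; have [v1 v2] := dv p Dp.
  by split; [exact: derivableD u1 v1|exact: derivableD u2 v2].
- apply: Ck_eq_on (IH _ _ ux vx) => p /set_mem Dp.
  by rewrite (deriveD (du p Dp).1 (dv p Dp).1).
- apply: Ck_eq_on (IH _ _ uy vy) => p /set_mem Dp.
  by rewrite (deriveD (du p Dp).2 (dv p Dp).2).
Qed.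

Lemma CkM k u v : Ck D k u -> Ck D k v -> Ck D k (u * v).
Proof.
elim: k u v => [|k IH] u v.
  move=> [cu _] [cv _].
  by split=> // p Dp; apply: continuousM; [exact: cu|exact: cv].
move=> Cu Cv; have [u0 v0] := (Ck_le Cu, Ck_le Cv).
case: Cu Cv => [cu [du ux uy]] [cv [dv vx vy]]; split=> [p Dp|].
  by apply: continuousM; [exact: cu|exact: cv].
split=> [p Dp| |].
- have [u1 u2] := du p Dp; have [v1 v2] := dv p Dp.
  by split; [exact: derivableM u1 v1|exact: derivableM u2 v2].
- apply: Ck_eq_on (CkD (IH _ _ u0 vx) (IH _ _ v0 ux)) => p /set_mem Dp.
  by rewrite (deriveM (du p Dp).1 (dv p Dp).1).
- apply: Ck_eq_on (CkD (IH _ _ u0 vy) (IH _ _ v0 uy)) => p /set_mem Dp.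
  by rewrite (deriveM (du p Dp).2 (dv p Dp).2).
Qed.

Lemma CkV k u : (forall p, D p -> u p != 0) ->
  Ck D k u -> Ck D k (fun p => (u p)^-1).
Proof.
move=> u0; elim: k => [|k IH].
  by move=> [cu _]; split=> // p Dp; apply: continuousV; [exact: u0|exact: cu].
move=> Cu; have iu := IH (Ck_le Cu).
case: Cu => cu [du ux uy]; split=> [p Dp|].
  by apply: continuousV; [exact: u0|exact: cu].
have iu2 := CkM (Ck_cst k (-1)) (CkM iu iu).
have E p (e : R * R) : D p -> derivable u p e ->
    (cst (-1) * ((fun p => (u p)^-1) * (fun p => (u p)^-1)) * 'D_e u) p =
    'D_e (fun p => (u p)^-1) p.
  move=> Dp d.
  by rewrite (deriveV (u0 p Dp) d) /GRing.mul /= mulN1r -invfM -expr2.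
split=> [p Dp| |].
- have [u1 u2] := du p Dp.
  by split; [exact: derivableV (u0 p Dp) u1|exact: derivableV (u0 p Dp) u2].
- apply: Ck_eq_on (CkM iu2 ux) => p /set_mem Dp.
  exact: E Dp (du p Dp).1.
- apply: Ck_eq_on (CkM iu2 uy) => p /set_mem Dp.
  exact: E Dp (du p Dp).2.
Qed.

Lemma smooth_cst (c : R) : smooth D (fun=> c).
Proof. by move=> k; exact: Ck_cst. Qed.

Lemma smoothD u v : smooth D u -> smooth D v -> smooth D (fun p => u p + v p).
Proof. by move=> su sv k; apply: CkD. Qed.

Lemma smoothM u v : smooth D u -> smooth D v -> smooth D (fun p => u p * v p).
Proof. by move=> su sv k; apply: CkM. Qed.

Lemma smoothN u : smooth D u -> smooth D (fun p => - u p).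
Proof.
move=> su k; apply: Ck_eq_on (CkM (Ck_cst k (-1)) (su k)) => p _.
by rewrite /GRing.mul /= mulN1r.
Qed.

Lemma smoothB u v : smooth D u -> smooth D v -> smooth D (fun p => u p - v p).
Proof. by move=> su sv; apply: smoothD => //; exact: smoothN. Qed.

Lemma smoothV u : (forall p, D p -> u p != 0) ->
  smooth D u -> smooth D (fun p => (u p)^-1).
Proof. by move=> u0 su k; exact: CkV. Qed.

Lemma smooth_eq_on u v : {in D, u =1 v} -> smooth D u -> smooth D v.
Proof. by move=> uv su k; exact: Ck_eq_on (su k). Qed.

Lemma smooth_continuous u p : smooth D u -> D p -> {for p, continuous u}.
Proof. by move=> su; have [cu _] := su 0; exact: cu. Qed.

Lemma smooth_derivable u p : smooth D u -> D p ->
  derivable u p (e_x R) /\ derivable u p (e_y R).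
Proof. by move=> su; have [_ [du _ _]] := su 1; exact: du. Qed.

(** This lifts differentiability to smoothness for a function known only
    through its partial derivatives, such as a primitive. *)
Lemma smooth_of_derive u (ux uy : R * R -> R) :
  (forall p, D p -> {for p, continuous u}) ->
  (forall p, D p -> is_derive p (e_x R) u (ux p)) ->
  (forall p, D p -> is_derive p (e_y R) u (uy p)) ->
  smooth D ux -> smooth D uy -> smooth D u.
Proof.
move=> cu dx dy sx sy [|k]; split=> //; split.
- by move=> p Dp; split; [case: (dx p Dp)|case: (dy p Dp)].
- by apply: Ck_eq_on (sx k) => p /set_mem /dx[_ ->].
- by apply: Ck_eq_on (sy k) => p /set_mem /dy[_ ->].
Qed.

End SmoothCalculus.

(** * Complex-valued functions and the Wirtinger operators *)

Section ComplexCalculus.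
Context {R : realType}.
Implicit Types (f g : R * R -> R[i]) (p e : R * R).

(** The two components are required to be derivable separately because
    [cderive] is defined by components. *)
Definition cderivable f p e : Prop :=
  derivable (fun q => complex.Re (f q)) p e /\
  derivable (fun q => complex.Im (f q)) p e.

Lemma cderive_cst (c : R[i]) p e : cderive e (fun=> c) p = 0.
Proof. by rewrite /cderive !derive_cst. Qed.

Lemma ReM (a b : R[i]) : complex.Re (a * b) =
  complex.Re a * complex.Re b - complex.Im a * complex.Im b.
Proof. by case: a b => [a1 a2] [b1 b2]. Qed.

Lemma ImM (a b : R[i]) : complex.Im (a * b) =
  complex.Re a * complex.Im b + complex.Im a * complex.Re b.
Proof. by case: a b => [a1 a2] [b1 b2]. Qed.

Lemma cderiveD f g p e : cderivable f p e -> cderivable g p e ->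
  cderive e (fun q => f q + g q) p = cderive e f p + cderive e g p.
Proof.
move=> [f1 f2] [g1 g2]; rewrite /cderive.
rewrite (_ : (fun q => complex.Re (f q + g q)) =
  (fun q => complex.Re (f q)) + (fun q => complex.Re (g q))); last first.
  by apply/funext => q; rewrite raddfD.
rewrite (_ : (fun q => complex.Im (f q + g q)) =
  (fun q => complex.Im (f q)) + (fun q => complex.Im (g q))); last first.
  by apply/funext => q; rewrite raddfD.
by rewrite (deriveD f1 g1) (deriveD f2 g2).
Qed.

Lemma cderiveM f g p e : cderivable f p e -> cderivable g p e ->
  cderive e (fun q => f q * g q) p = cderive e f p * g p + f p * cderive e g p.
Proof.
move=> [f1 f2] [g1 g2]; rewrite /cderive.
rewrite (_ : (fun q => complex.Re (f q * g q)) =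
  (fun q => complex.Re (f q)) * (fun q => complex.Re (g q)) -
  (fun q => complex.Im (f q)) * (fun q => complex.Im (g q))); last first.
  by apply/funext => q; rewrite ReM.
rewrite (_ : (fun q => complex.Im (f q * g q)) =
  (fun q => complex.Re (f q)) * (fun q => complex.Im (g q)) +
  (fun q => complex.Im (f q)) * (fun q => complex.Re (g q))); last first.
  by apply/funext => q; rewrite ImM.
rewrite (deriveB (derivableM f1 g1) (derivableM f2 g2)).
rewrite (deriveD (derivableM f1 g2) (derivableM f2 g1)).
rewrite (deriveM f1 g1) (deriveM f2 g2) (deriveM f1 g2) (deriveM f2 g1).
case: (f p) (g p) => [a b] [c d] /=.
move: ('D_e _ p) ('D_e _ p) ('D_e _ p) ('D_e _ p) => s t u v.
by apply/eqP; rewrite eq_complex /= /GRing.scale /=; apply/andP; split;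
  apply/eqP; ring.
Qed.

Lemma cderiveN f p e : cderivable f p e ->
  cderive e (fun q => - f q) p = - cderive e f p.
Proof.
move=> [f1 f2]; rewrite /cderive.
rewrite (_ : (fun q => complex.Re (- f q)) =
  - (fun q => complex.Re (f q))); last by apply/funext => q; rewrite raddfN.
rewrite (_ : (fun q => complex.Im (- f q)) =
  - (fun q => complex.Im (f q))); last by apply/funext => q; rewrite raddfN.
by rewrite (deriveN f1) (deriveN f2).
Qed.

Lemma cderive_conj f p e : cderivable f p e ->
  cderive e (fun q => (f q)^*%C) p = (cderive e f p)^*%C.
Proof.
move=> [f1 f2]; rewrite /cderive.
rewrite (_ : (fun q => complex.Re (f q)^*%C) = (fun q => complex.Re (f q)));
  last by apply/funext => q; case: (f q).
rewrite (_ : (fun q => complex.Im (f q)^*%C) = - (fun q => complex.Im (f q)));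
  last by apply/funext => q; rewrite /GRing.opp /=; case: (f q).
by rewrite (deriveN f2) /=; simpc.
Qed.

End ComplexCalculus.

Lemma conjcM {R : realType} (a b : R[i]) : (a * b)^*%C = a^*%C * b^*%C.
Proof. exact: rmorphM. Qed.

Lemma conjcD {R : realType} (a b : R[i]) : (a + b)^*%C = a^*%C + b^*%C.
Proof. exact: rmorphD. Qed.

Lemma conjcN {R : realType} (a : R[i]) : (- a)^*%C = - a^*%C.
Proof. exact: rmorphN. Qed.

Lemma conjcB {R : realType} (a b : R[i]) : (a - b)^*%C = a^*%C - b^*%C.
Proof. exact: rmorphB. Qed.

Section ComplexSmooth.
Context {R : realType} (D : set (R * R)).
Hypothesis oD : open D.
Implicit Types (f g : R * R -> R[i]) (p : R * R).

Lemma csmooth_eq_on f g : {in D, f =1 g} -> csmooth D f -> csmooth D g.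
Proof.
move=> fg [sf1 sf2].
by split; [apply: smooth_eq_on sf1|apply: smooth_eq_on sf2];
  move=> // p Dp; rewrite fg.
Qed.

Lemma csmooth_cst (c : R[i]) : csmooth D (fun=> c).
Proof. by split; exact: smooth_cst. Qed.

Lemma csmooth_real (u : R * R -> R) :
  smooth D u -> csmooth D (fun p => (u p)%:C).
Proof. by move=> su; split => //; exact: smooth_cst. Qed.

Lemma csmooth_conj f : csmooth D f -> csmooth D (fun p => (f p)^*%C).
Proof.
move=> [f1 f2]; split.
  by apply: smooth_eq_on f1 => // p _; case: (f p).
by apply: (smooth_eq_on oD _ (smoothN oD f2)) => p _; case: (f p).
Qed.

Lemma csmoothD f g :
  csmooth D f -> csmooth D g -> csmooth D (fun p => f p + g p).
Proof.
move=> [f1 f2] [g1 g2]; split.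
  by apply: (smooth_eq_on oD _ (smoothD oD f1 g1)) => p _; rewrite raddfD.
by apply: (smooth_eq_on oD _ (smoothD oD f2 g2)) => p _; rewrite raddfD.
Qed.

Lemma csmoothN f : csmooth D f -> csmooth D (fun p => - f p).
Proof.
move=> [f1 f2]; split.
  by apply: (smooth_eq_on oD _ (smoothN oD f1)) => p _; rewrite raddfN.
by apply: (smooth_eq_on oD _ (smoothN oD f2)) => p _; rewrite raddfN.
Qed.

Lemma csmoothM f g :
  csmooth D f -> csmooth D g -> csmooth D (fun p => f p * g p).
Proof.
move=> [f1 f2] [g1 g2]; split.
  apply: (smooth_eq_on oD _ (smoothB oD (smoothM oD f1 g1) (smoothM oD f2 g2))).
  by move=> p _; rewrite ReM.
apply: (smooth_eq_on oD _ (smoothD oD (smoothM oD f1 g2) (smoothM oD f2 g1))).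
by move=> p _; rewrite ImM.
Qed.

Lemma csmooth_cderivable f p : csmooth D f -> D p ->
  cderivable f p (e_x R) /\ cderivable f p (e_y R).
Proof.
move=> [f1 f2] Dp.
have [a1 a2] := smooth_derivable f1 Dp; have [b1 b2] := smooth_derivable f2 Dp.
exact: (conj (conj a1 b1) (conj a2 b2)).
Qed.

Lemma cderive_eq_on f g p e : {in D, f =1 g} -> D p ->
  cderive e f p = cderive e g p.
Proof.
move=> fg Dp; rewrite /cderive.
by congr (_ +i* _); apply: (derive_eq_on oD) (mem_set Dp) => q Dq; rewrite fg.
Qed.

Lemma del_eq_on f g p : {in D, f =1 g} -> D p -> del f p = del g p.
Proof. by move=> fg Dp; rewrite /del !(cderive_eq_on _ fg Dp). Qed.

Lemma del_cst (c : R[i]) p : del (fun=> c) p = 0.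
Proof. by rewrite /del !cderive_cst mulr0 subr0 mulr0. Qed.

Lemma delD f g p : csmooth D f -> csmooth D g -> D p ->
  del (fun q => f q + g q) p = del f p + del g p.
Proof.
move=> sf sg Dp; rewrite /del.
have [f1 f2] := csmooth_cderivable sf Dp.
have [g1 g2] := csmooth_cderivable sg Dp.
rewrite (cderiveD f1 g1) (cderiveD f2 g2).
move: (cderive (e_x R) f p) (cderive (e_y R) f p) => a b.
move: (cderive (e_x R) g p) (cderive (e_y R) g p) => c d.
by move: 'i%C => j; ring.
Qed.

Lemma delN f p : csmooth D f -> D p -> del (fun q => - f q) p = - del f p.
Proof.
move=> sf Dp; rewrite /del; have [f1 f2] := csmooth_cderivable sf Dp.
rewrite (cderiveN f1) (cderiveN f2).
move: (cderive (e_x R) f p) (cderive (e_y R) f p) => a b.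
by move: 'i%C => j; ring.
Qed.

Lemma delM f g p : csmooth D f -> csmooth D g -> D p ->
  del (fun q => f q * g q) p = del f p * g p + f p * del g p.
Proof.
move=> sf sg Dp; rewrite /del.
have [f1 f2] := csmooth_cderivable sf Dp.
have [g1 g2] := csmooth_cderivable sg Dp.
rewrite (cderiveM f1 g1) (cderiveM f2 g2).
move: (cderive (e_x R) f p) (cderive (e_y R) f p) => a b.
move: (cderive (e_x R) g p) (cderive (e_y R) g p) => c d.
by move: 'i%C => j; ring.
Qed.

(** Conjugation exchanges the two operators, so that Leibniz rules are only
    needed for [del]. *)
Lemma delbar_conj f p : csmooth D f -> D p ->
  delbar f p = (del (fun q => (f q)^*%C) p)^*%C.
Proof.
move=> sf Dp; rewrite /del /delbar.
have [f1 f2] := csmooth_cderivable sf Dp.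
rewrite (cderive_conj f1) (cderive_conj f2).
have i2 : (2^-1 : R[i])^*%C = 2^-1 by rewrite conjc_inv conjc_nat.
have ci : ('i%C : R[i])^*%C = - 'i%C by simpc.
rewrite conjcM i2 conjcB conjcM ci !conjcK.
move: (cderive (e_x R) f p) (cderive (e_y R) f p) => a b.
by move: 'i%C => j; ring.
Qed.

End ComplexSmooth.

(** * Segments and contours *)

Section Segments.
Context {R : realType}.
Implicit Types (D : set (R * R)) (P Q : R * R).

Definition segment P Q (t : R) : R * R := P + t *: (Q - P).

Lemma segment0 P Q : segment P Q 0 = P.
Proof. by rewrite /segment scale0r addr0. Qed.

Lemma segment1 P Q : segment P Q 1 = Q.
Proof. by rewrite /segment scale1r addrC subrK. Qed.

Lemma is_derive_segment P Q (t : R) : is_derive t 1 (segment P Q) (Q - P).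
Proof.
have E : (fun h : R => h^-1 *: (segment P Q (h *: 1 + t) - segment P Q t)) @ 0^'
    --> Q - P.
  apply: cvg_near_cst; near=> h.
  have h0 : h != 0 by near: h; exact: nbhs_dnbhs_neq.
  rewrite /segment scalerDl opprD addrACA subrr add0r addrK scalerA.
  by rewrite [_ *: 1]mulr1 mulVf // scale1r.
by apply: DeriveDef; [apply/cvg_ex; exists (Q - P)|exact: cvg_lim].
Unshelve. all: by end_near. Qed.

Lemma derive1_segment P Q : derive1 (segment P Q) = cst (Q - P).
Proof.
by apply/funext => t; rewrite derive1E; case: (is_derive_segment P Q t).
Qed.

Lemma continuous_segment P Q : continuous (segment P Q).
Proof.
move=> t; apply/differentiable_continuous/derivable1_diffP.
by case: (is_derive_segment P Q t).
Qed.

Lemma segment_ball P Q (e t : R) : ball P e Q -> t \in `[0, 1] ->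
  ball P e (segment P Q t).
Proof.
case: P Q => [p1 p2] [q1 q2] [/= b1 b2]; rewrite in_itv /= => /andP[t0 t1].
rewrite -!ball_normE /= in b1 b2.
have H (a b : R) : `|a - b| < e -> `|a - (a + t * (b - a))| < e.
  move=> ab; rewrite opprD addrA subrr sub0r normrN normrM ger0_norm //.
  by apply: le_lt_trans ab; rewrite distrC ler_piMl.
by split=> /=; rewrite -ball_normE /=; exact: H.
Qed.

Lemma C1_arc_segment D P Q : (forall t, t \in `[0, 1] -> D (segment P Q t)) ->
  C1_arc D (segment P Q).
Proof.
move=> DPQ; split=> //; last first.
  by rewrite derive1_segment => ?; exact: cst_continuous.
by move=> t; case: (is_derive_segment P Q t).
Qed.

Lemma contour_rcons D P Q c g : contour D P Q c -> C1_arc D g -> g 0 = Q ->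
  contour D P (g 1) (rcons c g).
Proof.
move=> + Cg gQ; elim: c P => [|h c IH] P /=; first by move=> ->.
by move=> [Ch hP cQ]; split=> //; exact: IH.
Qed.

(** The points that can be reached from a given one, and those that cannot, both
    form open sets, because a ball inside the domain contains the segments from
    its centre; by connectedness there are none of the second kind. *)
Lemma contour_exists D P Q : open D -> connected D -> D P -> D Q ->
  exists c, contour D P Q c.
Proof.
move=> oD cD DP DQ.
pose C := [set X | D X /\ exists c, contour D P X c].
have nearC X : D X -> \forall Y \near X, D Y /\ (C Y <-> C X).
  move=> DX; have /nbhs_ballP[e /= e0 eD] := open_nbhs_nbhs (conj oD DX).
  apply/nbhs_ballP; exists e => //= Y bY; split; first exact: eD.
  (split=> -[DZ [c Pc]]; split); [exact: DX| |exact: eD|].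
  - exists (rcons c (segment Y X)); rewrite -[X in contour D P X](segment1 Y X).
    apply: contour_rcons Pc _ (segment0 _ _); apply: C1_arc_segment => t t01.
    (* The ball is centred at X, so the segment has to be run backwards. *)
    apply: eD; rewrite (_ : segment Y X t = segment X Y (1 - t)).
      apply: segment_ball => //; move: t01; rewrite !in_itv /= => /andP[? ?].
      by apply/andP; split; lra.
    rewrite /segment scalerBl scale1r addrA (addrC X) subrK.
    by rewrite -scalerN opprB.
  - exists (rcons c (segment X Y)); rewrite -[Y in contour D P Y](segment1 X Y).
    apply: contour_rcons Pc _ (segment0 _ _); apply: C1_arc_segment => t t01.
    by apply: eD; exact: segment_ball.
have CP : C P by split=> //; exists [::].
suff DC : D = C.
  by have [] : C Q by rewrite -DC.
apply/esym/cD; first by exists P.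
- exists C; last first.
    by apply/seteqP; split=> X; [move=> CX; split => //; case: CX|case].
  rewrite openE => X CX; have [DX _] := CX.
  by apply: filterS (nearC _ DX) => Y [_ [_]]; exact.
- exists (~` (D `\` C)).
    apply: open_closedC; rewrite openE => X [DX nCX].
    by apply: filterS (nearC _ DX) => Y [DY [CY _]]; split=> // /CY.
  apply/seteqP; split=> X; first by move=> CX; split; [case: CX|case].
  by move=> [DX nDC]; apply: contrapT => nCX; exact: nDC.
Qed.

End Segments.

(** * Primitives of continuous forms *)

Section Primitive.
Context {R : realType} (D : set (R * R)).
Hypothesis oD : open D.
Variables (F gx gy : R * R -> R).
Hypothesis cgx : forall p, D p -> {for p, continuous gx}.
Hypothesis cgy : forall p, D p -> {for p, continuous gy}.
Hypothesis FE : forall P Q, D P ->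
  (forall t, t \in `[0, 1] -> D (segment P Q t)) ->
  F Q - F P = \int[lebesgue_measure]_(t in `[0%R, 1%R])
    (gx (segment P Q t) * (Q.1 - P.1) + gy (segment P Q t) * (Q.2 - P.2)).

(** On a small ball the integrand stays within [e (|dx| + |dy|)] of its value at
    the centre, hence so does its integral over [0, 1]. *)
Lemma primitive_estimate P (e : R) : D P -> 0 < e ->
  \forall Q \near P,
    `|F Q - F P - (gx P * (Q.1 - P.1) + gy P * (Q.2 - P.2))|
    <= e * (`|Q.1 - P.1| + `|Q.2 - P.2|).
Proof.
move=> DP e0.
have nD : \forall q \near P, D q := open_nbhs_nbhs (conj oD DP).
have nx : \forall q \near P, `|gx P - gx q| <= e.
  by move/cvgrPdist_le : (cgx DP); exact.
have ny : \forall q \near P, `|gy P - gy q| <= e.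
  by move/cvgrPdist_le : (cgy DP); exact.
have /nbhs_ballP[d /= d0 dP] : \forall q \near P,
    [/\ D q, `|gx P - gx q| <= e & `|gy P - gy q| <= e].
  by near=> q; split; near: q.
apply/nbhs_ballP; exists d => //= Q bQ.
have segP t : t \in `[0, 1] -> _ := fun t01 => dP _ (segment_ball bQ t01).
rewrite FE //; last by move=> t /segP[].
set dx := Q.1 - P.1; set dy := Q.2 - P.2.
set L := gx P * dx + gy P * dy; set M := e * _.
set h := fun t => gx (segment P Q t) * dx + gy (segment P Q t) * dy.
have hL t : t \in `[0, 1] -> `|h t - L| <= M.
  move=> /segP[_ x1 y1]; rewrite /h /L /M.
  rewrite opprD addrACA -!mulrBl (le_trans (ler_normD _ _)) // !normrM.
  by rewrite mulrDr; apply: lerD; rewrite ler_wpM2r // distrC.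
have ih : lebesgue_measure.-integrable `[0, 1] (EFin \o h).
  apply: continuous_compact_integrable; first exact: segment_compact.
  apply: continuous_in_subspaceT => t /set_mem /= /segP[Dt _ _].
  apply: cvgD; apply: cvgMr_tmp.
    by apply: continuous_comp; [exact: continuous_segment|exact: cgx].
  by apply: continuous_comp; [exact: continuous_segment|exact: cgy].
have ic (c : R) : lebesgue_measure.-integrable `[0, 1] (EFin \o cst c : R -> _).
  apply: continuous_compact_integrable; first exact: segment_compact.
  by apply: continuous_subspaceT => t; exact: cst_continuous.
have vc (c : R) : \int[lebesgue_measure]_(t in `[0, 1]) (cst c t : R) = c.
  rewrite Rintegral_cst //= lebesgue_measure_itv /= lte_fin ltr01.
  by rewrite oppr0 addr0 mulr1.
rewrite ler_distl; apply/andP; split.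
  rewrite -[leLHS]vc; apply: le_Rintegral => // t /hL.
  by rewrite ler_distl => /andP[].
rewrite -[leRHS]vc; apply: le_Rintegral => // t /hL.
by rewrite ler_distl => /andP[].
Unshelve. all: by end_near. Qed.

Lemma primitive_is_derive P v : D P ->
  is_derive P v F (gx P * v.1 + gy P * v.2).
Proof.
move=> DP; set L := _ + _.
have E : (fun h : R => h^-1 *: (F (h *: v + P) - F P)) @ 0^' --> L.
  apply/cvgrPdist_le => e e0.
  (* Adding 1 keeps the denominator positive when v is zero. *)
  pose n := `|v.1| + `|v.2| + 1.
  have n0 : 0 < n by rewrite /n ltr_wpDl // addr_ge0.
  have := primitive_estimate DP (divr_gt0 e0 n0).
  have c0 : (fun h : R => h *: v + P) @ 0 --> P.
    have : continuous (fun h : R => h *: v + P).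
      by move=> h; apply: cvgD; [exact: scalel_continuous|exact: cvg_cst].
    by move=> /(_ 0); rewrite /continuous_at scale0r add0r.
  move=> /c0 /nbhs_dnbhs est; near=> h.
  have h0 : h != 0 by near: h; exact: nbhs_dnbhs_neq.
  have : `|F (h *: v + P) - F P - (gx P * ((h *: v + P).1 - P.1) +
      gy P * ((h *: v + P).2 - P.2))| <=
      e / n * (`|(h *: v + P).1 - P.1| + `|(h *: v + P).2 - P.2|).
    by near: h.
  have -> : (h *: v + P).1 - P.1 = h * v.1 by rewrite /= addrK.
  have -> : (h *: v + P).2 - P.2 = h * v.2 by rewrite /= addrK.
  rewrite !normrM -mulrDr.
  rewrite (mulrCA (gx P)) (mulrCA (gy P)) -mulrDr -/L => le.
  have -> : L - h^-1 *: (F (h *: v + P) - F P) =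
      - (h^-1 * (F (h *: v + P) - F P - h * L)).
    by rewrite mulrBr mulKf // opprB.
  rewrite normrN normrM normfV ler_pdivrMl ?normr_gt0 //.
  rewrite (le_trans le) // mulrCA ler_pM2l ?normr_gt0 //.
  by rewrite -mulrA ler_piMr ?(ltW e0) // ler_pdivrMl // mulr1 /n lerDl.
by apply: DeriveDef; [apply/cvg_ex; exists L|exact: cvg_lim].
Unshelve. all: by end_near. Qed.

Lemma primitive_continuous P : D P -> {for P, continuous F}.
Proof.
move=> DP; apply/cvgrPdist_le => e e0.
(* By the estimate with constant 1, F is Lipschitz at P with constant k for the
   norm |dx| + |dy|; the factor 2 below accounts for the two coordinates. *)
pose k := `|gx P| + `|gy P| + 1.
have k0 : 0 < k by rewrite /k ltr_wpDl // addr_ge0.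
pose d := e / (2 * k).
have d0 : 0 < d by rewrite divr_gt0 // mulr_gt0.
have nd : \forall Q \near P, ball P d Q by exact: nbhsx_ballx.
near=> Q.
have est : `|F Q - F P - (gx P * (Q.1 - P.1) + gy P * (Q.2 - P.2))|
    <= 1 * (`|Q.1 - P.1| + `|Q.2 - P.2|).
  by near: Q; exact: primitive_estimate.
have [b1 b2] : ball P d Q by near: Q. 
rewrite -ball_normE /= in b1 b2.
rewrite distrC in b1; rewrite distrC in b2.
rewrite mul1r in est; rewrite distrC.
set dx := Q.1 - P.1 in est b1 *; set dy := Q.2 - P.2 in est b2 *.
rewrite -[F Q - F P](subrK (gx P * dx + gy P * dy)).
rewrite (le_trans (ler_normD _ _)) //.
have L : `|gx P * dx + gy P * dy| <= `|gx P| * `|dx| + `|gy P| * `|dy|.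
  by rewrite -!normrM ler_normD.
have E : e = 2 * (`|gx P| * d + `|gy P| * d + d).
  have kn : k != 0 by rewrite gt_eqF.
  by rewrite -mulrDl -[in X in _ + X](mul1r d) -mulrDl -/k /d; field.
have X : `|gx P| * `|dx| <= `|gx P| * d by rewrite ler_wpM2l // ltW.
have Y : `|gy P| * `|dy| <= `|gy P| * d by rewrite ler_wpM2l // ltW.
have X0 : 0 <= `|gx P| * d by rewrite mulr_ge0 // ltW.
have Y0 : 0 <= `|gy P| * d by rewrite mulr_ge0 // ltW.
rewrite E; clear E; lra.
Unshelve. all: by end_near. Qed.

End Primitive.

Section ComplexPrimitive.
Context {R : realType} (D : set (R * R)).
Hypothesis oD : open D.
Variables (F A B : R * R -> R[i]).
Hypotheses (sA : csmooth D A) (sB : csmooth D B).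
Hypothesis FE : forall P Q, D P ->
  (forall t, t \in `[0, 1] -> D (segment P Q t)) ->
  F Q - F P = cintegral01 (fun t =>
    A (segment P Q t) * velocity (segment P Q) t +
    B (segment P Q t) * (velocity (segment P Q) t)^*%C).

(* The 1-form A dz + B dzbar is Fx dx + Fy dy. *)
Let Fx p := A p + B p.
Let Fy p := 'i%C * (A p - B p).

Let sFx : csmooth D Fx. Proof. exact: csmoothD. Qed.
Let sFy : csmooth D Fy.
Proof.
apply: csmoothM => //; first exact: csmooth_cst.
by apply: csmoothD => //; exact: csmoothN.
Qed.

Lemma form_velocity P Q t :
  A (segment P Q t) * velocity (segment P Q) t +
    B (segment P Q t) * (velocity (segment P Q) t)^*%C =
  (complex.Re (Fx (segment P Q t)) * (Q.1 - P.1) +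
   complex.Re (Fy (segment P Q t)) * (Q.2 - P.2)) +i*
  (complex.Im (Fx (segment P Q t)) * (Q.1 - P.1) +
   complex.Im (Fy (segment P Q t)) * (Q.2 - P.2)).
Proof.
rewrite /velocity derive1_segment /Fx /Fy /=.
case: (A _) (B _) => [a b] [c d]; apply/eqP; rewrite eq_complex /=.
by apply/andP; split; apply/eqP; ring.
Qed.

Lemma Re_primitive P Q : D P ->
  (forall t, t \in `[0, 1] -> D (segment P Q t)) ->
  complex.Re (F Q) - complex.Re (F P) =
  \int[lebesgue_measure]_(t in `[0%R, 1%R])
    (complex.Re (Fx (segment P Q t)) * (Q.1 - P.1) +
     complex.Re (Fy (segment P Q t)) * (Q.2 - P.2)).
Proof.
move=> DP DPQ; rewrite -raddfB /= FE //=; apply: eq_Rintegral => t _.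
by rewrite form_velocity.
Qed.

Lemma Im_primitive P Q : D P ->
  (forall t, t \in `[0, 1] -> D (segment P Q t)) ->
  complex.Im (F Q) - complex.Im (F P) =
  \int[lebesgue_measure]_(t in `[0%R, 1%R])
    (complex.Im (Fx (segment P Q t)) * (Q.1 - P.1) +
     complex.Im (Fy (segment P Q t)) * (Q.2 - P.2)).
Proof.
move=> DP DPQ; rewrite -raddfB /= FE //=; apply: eq_Rintegral => t _.
by rewrite form_velocity.
Qed.

(** The real and imaginary parts are primitives of real forms, with partial
    derivatives the parts of [A + B] and [i (A - B)]; these are smooth, hence so
    is [F], and the combinations in [del] and [delbar] isolate [A] and [B]. *)
Lemma primitive_csmooth :
  csmooth D F /\ forall p, D p -> del F p = A p /\ delbar F p = B p.
Proof.
have [[rx ix] [ry iy]] := (sFx, sFy).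
have crx p := smooth_continuous rx (p := p).
have cix p := smooth_continuous ix (p := p).
have cry p := smooth_continuous ry (p := p).
have ciy p := smooth_continuous iy (p := p).
have dRx p : D p ->
    is_derive p (e_x R) (fun p => complex.Re (F p)) (complex.Re (Fx p)).
  move=> Dp; have d := primitive_is_derive oD crx cry Re_primitive (e_x R) Dp.
  by apply: is_derive_eq; rewrite /= mulr1 mulr0 addr0.
have dRy p : D p ->
    is_derive p (e_y R) (fun p => complex.Re (F p)) (complex.Re (Fy p)).
  move=> Dp; have d := primitive_is_derive oD crx cry Re_primitive (e_y R) Dp.
  by apply: is_derive_eq; rewrite /= mulr1 mulr0 add0r.
have dIx p : D p ->
    is_derive p (e_x R) (fun p => complex.Im (F p)) (complex.Im (Fx p)).
  move=> Dp; have d := primitive_is_derive oD cix ciy Im_primitive (e_x R) Dp.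
  by apply: is_derive_eq; rewrite /= mulr1 mulr0 addr0.
have dIy p : D p ->
    is_derive p (e_y R) (fun p => complex.Im (F p)) (complex.Im (Fy p)).
  move=> Dp; have d := primitive_is_derive oD cix ciy Im_primitive (e_y R) Dp.
  by apply: is_derive_eq; rewrite /= mulr1 mulr0 add0r.
split.
  split; apply: smooth_of_derive => //.
    by move=> p; exact: (primitive_continuous oD crx cry Re_primitive).
  by move=> p; exact: (primitive_continuous oD cix ciy Im_primitive).
have cE (a : R[i]) : complex.Re a +i* complex.Im a = a by case: a.
move=> p Dp; rewrite /del /delbar /cderive.
have [[_ ->] [_ ->]] := (dRx p Dp, dRy p Dp).
have [[_ ->] [_ ->]] := (dIx p Dp, dIy p Dp).
have ii : 'i%C * 'i%C = -1 :> R[i] by rewrite -expr2 sqr_i.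
rewrite !cE /Fx /Fy; move: (A p) (B p) ii; move: 'i%C => j a b jj.
by split; field: jj.
Qed.

End ComplexPrimitive.

Lemma del_conj {R : realType} (D : set (R * R)) f p : open D -> csmooth D f ->
  D p -> del (fun q => (f q)^*%C) p = (delbar f p)^*%C.
Proof. by move=> oD sf Dp; rewrite (delbar_conj sf Dp) conjcK. Qed.

Lemma mx2E (K : Type) (a b c d : K) :
  ((mx2 a b c d 0 0 = a) * (mx2 a b c d 0 1 = b)) *
  ((mx2 a b c d 1 0 = c) * (mx2 a b c d 1 1 = d)).
Proof. by rewrite !mxE. Qed.

(** * The surface defined by its integral formula *)

Section Surface.
Context {R : realType} (D : set (R * R)).
Hypothesis oD : open D.

(** The first column of the matrix suffices: its entries [i x3] and [x1 - i x2]
    determine the point, and the coordinates are recovered by conjugation. *)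
Lemma weierstrass_of_integral (psi : R * R -> 'cV[R[i]]_2) P0
    (r : R * R -> 'rV[R]_3) :
  connected D -> mxsmooth D psi -> D P0 ->
  (forall P c, contour D P0 P c ->
     su2mx (r P) = su2mx (r P0) + 'i%C *:
       line_integral (fun p => weierstrass_dz (psi p))
                     (fun p => weierstrass_dzbar (psi p)) c) ->
  weierstrass D psi r.
Proof.
move=> cD spsi DP0 SE.
pose A p := weierstrass_dz (psi p); pose B p := weierstrass_dzbar (psi p).
have step P Q : D P -> (forall t, t \in `[0, 1] -> D (segment P Q t)) ->
    su2mx (r Q) = su2mx (r P) + 'i%C *: arc_integral A B (segment P Q).
  move=> DP DPQ; have [c Pc] := contour_exists oD cD DP0 DP.
  have := contour_rcons Pc (C1_arc_segment DPQ) (segment0 _ _).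
  rewrite segment1 => /SE ->; rewrite (SE _ _ Pc) -addrA; congr (_ + _).
  by rewrite -scalerDr /line_integral -cats1 big_cat big_seq1.
have ii : 'i%C * 'i%C = -1 :> R[i] by rewrite -expr2 sqr_i.
(* Dividing by i turns the entries of S into primitives of those of
   A dz + B dzbar. *)
pose F i j p := - 'i%C * su2mx (r p) i j.
have FE i j P Q : D P -> (forall t, t \in `[0, 1] -> D (segment P Q t)) ->
    F i j Q - F i j P = cintegral01 (fun t =>
      A (segment P Q t) i j * velocity (segment P Q) t +
      B (segment P Q t) i j * (velocity (segment P Q) t)^*%C).
  move=> DP DPQ; rewrite /F (step P Q DP DPQ) !mxE.
  set I := cintegral01 _; rewrite mulrDr addrAC subrr add0r mulrA mulNr ii.
  by rewrite opprK mul1r.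
have s0 := spsi 0 0; have s1 := spsi 1 0.
have c0 := csmooth_conj oD s0; have c1 := csmooth_conj oD s1.
have A00 : (fun p => A p 0 0) = fun p => psi p 0 0 * (psi p 1 0)^*%C.
  by apply/funext => p; rewrite !mxE.
have B00 : (fun p => B p 0 0) = fun p => (psi p 0 0)^*%C * psi p 1 0.
  by apply/funext => p; rewrite !mxE.
have A10 : (fun p => A p 1 0) = fun p => psi p 0 0 * psi p 0 0.
  by apply/funext => p; rewrite !mxE /= expr2.
have B10 : (fun p => B p 1 0) = fun p => - (psi p 1 0 * psi p 1 0).
  by apply/funext => p; rewrite !mxE /= expr2.
have [f2 d2] : csmooth D (F 0 0) /\
    forall p, D p -> del (F 0 0) p = A p 0 0 /\ delbar (F 0 0) p = B p 0 0.
  apply: primitive_csmooth (FE 0 0) => //; first by rewrite A00; exact: csmoothM.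
  by rewrite B00; exact: csmoothM.
have [f1 d1] : csmooth D (F 1 0) /\
    forall p, D p -> del (F 1 0) p = A p 1 0 /\ delbar (F 1 0) p = B p 1 0.
  apply: primitive_csmooth (FE 1 0) => //; first by rewrite A10; exact: csmoothM.
  by rewrite B10; apply: csmoothN => //; exact: csmoothM.
have cf1 := csmooth_conj oD f1.
have two : (2 : R[i]) != 0 by rewrite pnatr_eq0.
have r0E : (fun q => (r q 0 0)%:C) =
    fun q => 'i%C / 2 * (F 1 0 q + - (F 1 0 q)^*%C).
  apply/funext => q; rewrite /F mx2E conjcM conjcB conjcN conjcM !conjc_real.
  have -> : ('i%C : R[i])^*%C = - 'i%C by simpc.
  by move: 'i%C ii (_%:C) (_%:C) => j jj x y; field: jj.
have r1E : (fun q => (r q 0 1)%:C) =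
    fun q => - 2^-1 * (F 1 0 q + (F 1 0 q)^*%C).
  apply/funext => q; rewrite /F mx2E conjcM conjcB conjcN conjcM !conjc_real.
  have -> : ('i%C : R[i])^*%C = - 'i%C by simpc.
  by move: 'i%C ii (_%:C) (_%:C) => j jj x y; field: jj.
have r2E : (fun q => (r q 0 2)%:C) = F 0 0.
  apply/funext => q; rewrite /F mx2E mulrA mulNr ii.
  by rewrite opprK mul1r.
have sr0 : csmooth D (fun q => (r q 0 0)%:C).
  rewrite r0E; apply: csmoothM => //; first exact: csmooth_cst.
  by apply: csmoothD => //; exact: csmoothN.
have sr1 : csmooth D (fun q => (r q 0 1)%:C).
  by rewrite r1E; apply: csmoothM => //; [exact: csmooth_cst|exact: csmoothD].
have sr2 : csmooth D (fun q => (r q 0 2)%:C) by rewrite r2E.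
split.
  case=> -[|[|[|//]]] lt3.
  - by rewrite (_ : Ordinal lt3 = 0); [case: sr0|exact/val_inj].
  - by rewrite (_ : Ordinal lt3 = 1); [case: sr1|exact/val_inj].
  - by rewrite (_ : Ordinal lt3 = 2); [case: sr2|exact/val_inj].
move=> p Dp psi1 psi2.
have [d2A _] := d2 p Dp; have [d1A d1B] := d1 p Dp.
have dc : del (fun q => (F 1 0 q)^*%C) p = - (psi2^*%C ^+ 2).
  by rewrite (del_conj oD f1 Dp) d1B (congr1 (@^~ p) B10) conjcN conjcM expr2.
have dA : del (F 1 0) p = psi1 ^+ 2 by rewrite d1A (congr1 (@^~ p) A10) expr2.
split.
- have sB := csmoothD oD f1 (csmoothN oD cf1).
  rewrite r0E (delM (csmooth_cst D _) sB Dp) del_cst mul0r add0r.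
  by rewrite (delD f1 (csmoothN oD cf1) Dp) (delN cf1 Dp) dc dA opprK.
- have sD := csmoothD oD f1 cf1.
  rewrite r1E (delM (csmooth_cst D _) sD Dp) del_cst mul0r add0r.
  rewrite (delD f1 cf1 Dp) dc dA.
  by move: (psi1 ^+ 2) (psi2^*%C ^+ 2) => a b; ring.
- by rewrite r2E d2A (congr1 (@^~ p) A00).
Qed.

End Surface.

(** * Inversion in matrix form *)

Section Inversion.
Context {R : realType}.
Implicit Types (x : 'rV[R]_3) (v : 'cV[R[i]]_2).

Lemma mulmx2 (K : pzRingType) (A B : 'M[K]_2) i j :
  (A *m B) i j = A i 0 * B 0 j + A i 1 * B 1 j.
Proof.
rewrite mxE !big_ord_recl big_ord0 addr0.
by congr (_ + A _ _ * B _ _); exact/val_inj.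
Qed.

Lemma mx2P (K : Type) (A B : 'M[K]_2) : A 0 0 = B 0 0 -> A 0 1 = B 0 1 ->
  A 1 0 = B 1 0 -> A 1 1 = B 1 1 -> A = B.
Proof.
move=> e00 e01 e10 e11; apply/matrixP => i j.
have ord2 (k : 'I_2) : k = 0 \/ k = 1.
  by case: k => -[|[|//]] lt2; [left|right]; exact/val_inj.
by have [->|->] := ord2 i; have [->|->] := ord2 j.
Qed.

Lemma sum3 (F : 'I_3 -> R) : \sum_k F k = F 0 + F 1 + F 2.
Proof.
rewrite !big_ord_recl big_ord0 addr0 addrA.
by congr (F _ + F _ + F _); exact/val_inj.
Qed.

Lemma sqr_norm_eq0 x : (\sum_k x 0 k ^+ 2 == 0) = (x == 0).
Proof.
apply/idP/eqP => [|->]; last by rewrite big1 // => k _; rewrite mxE expr0n.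
rewrite psumr_eq0 => [/allP x0|k _]; last exact: sqr_ge0.
apply/rowP => k; rewrite mxE; apply/eqP.
by rewrite -sqrf_eq0; apply: x0; rewrite mem_index_enum.
Qed.

Lemma su2mx0 : su2mx 0 = 0 :> 'M[R[i]]_2.
Proof. by apply: mx2P; rewrite mx2E !mxE; simpc. Qed.

Lemma inversionE x k :
  inversion x 0 k = - ((x 0 0 ^+ 2 + x 0 1 ^+ 2 + x 0 2 ^+ 2)^-1 * x 0 k).
Proof. by rewrite /inversion sum3 mxE mulNr. Qed.

Lemma imaginary_sqr : 'i%C * 'i%C = -1 :> R[i].
Proof. by rewrite -expr2 sqr_i. Qed.

Lemma real_complexM (a b : R) : (a * b)%:C = a%:C * b%:C :> R[i].
Proof. exact: rmorphM. Qed.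

Lemma real_complexN (a : R) : (- a)%:C = - a%:C :> R[i].
Proof. exact: rmorphN. Qed.

Lemma real_complexD (a b : R) : (a + b)%:C = a%:C + b%:C :> R[i].
Proof. exact: rmorphD. Qed.

(** A traceless matrix satisfies [X ^ 2 = - det X], and the determinant is here
    the square of the Euclidean norm. *)
Lemma su2mx_inversion x : x != 0 -> su2mx x *m su2mx (inversion x) = 1%:M.
Proof.
rewrite -sqr_norm_eq0 sum3 => n0.
have mn := mulVf n0; move/(congr1 (real_complex R)): mn.
have -> : 1%:M = mx2 1 0 0 1 :> 'M[R[i]]_2 by apply: mx2P; rewrite !mx2E !mxE.
rewrite real_complexM !real_complexD !expr2 !real_complexM.
rewrite (rmorph1 (real_complex R)) => mn.
have ii := imaginary_sqr.
apply: mx2P;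
  rewrite mulmx2 !mx2E !inversionE !expr2 !real_complexN !real_complexM;
  move: mn ii; set m := (_^-1)%:C;
  move: 'i%C m (x 0 0)%:C (x 0 1)%:C (x 0 2)%:C => j m a b c mn jj;
  rewrite -?mn; ring: jj.
Qed.

(** The equality holds at the origin as well, where both sides are zero by
    convention; it can therefore be used to rewrite functions on the whole
    plane. *)
Lemma invmx_su2mx x : invmx (su2mx x) = su2mx (inversion x).
Proof.
have [->|x0] := eqVneq x 0.
  by rewrite /inversion scaler0 su2mx0 /invmx unitmxE det0 unitr0.
have E := su2mx_inversion x0; have [U _] := mulmx1_unit E.
by rewrite -[RHS](mulKmx U) E mulmx1.
Qed.

Lemma conjc_imaginary : ('i%C : R[i])^*%C = - 'i%C.
Proof. by simpc. Qed.

(** Matrices of the form of [spinor_mx] are the real quaternions, [su(2)] the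
    imaginary ones, and quaternions are closed under product. *)
Lemma spinor_mx_su2mx v x :
  spinor_mx v *m su2mx x = spinor_mx (col 0 (spinor_mx v *m su2mx x)).
Proof.
have cE (A : 'M[R[i]]_2) i j : (col 0 A) i j = A i 0 by rewrite mxE.
apply: mx2P; rewrite [RHS]mx2E !cE // !mulmx2 !mx2E;
  rewrite !(conjcD, conjcM, conjcN, conjcB, conjcK, conjc_real, conjc_imaginary);
  ring.
Qed.

End Inversion.
Lemma col_spinor_su2 {R : realType} (v : 'cV[R[i]]_2) (x : 'rV[R]_3) :
  let w := col 0 (spinor_mx v *m su2mx x) in
  (w 0 0 = v 0 0 * ('i%C * (x 0 2)%:C) -
           (v 1 0)^*%C * ((x 0 0)%:C - 'i%C * (x 0 1)%:C)) *
  (w 1 0 = v 1 0 * ('i%C * (x 0 2)%:C) +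
           (v 0 0)^*%C * ((x 0 0)%:C - 'i%C * (x 0 1)%:C)).
Proof.
have cE (A : 'M[R[i]]_2) k : (col 0 A) k 0 = A k 0 by rewrite mxE.
by split; rewrite /= cE mulmx2 !mx2E ?mulNr.
Qed.

Section InvertedSurface.
Context {R : realType} (D : set (R * R)).
Hypothesis oD : open D.

(** The derivative of the inverse [m] of the squared norm comes from
    differentiating [m N = 1].  What remains is the polynomial identity between
    [- S^-1 (del S) S^-1] and the rank one matrix built on [w0 S^-1], modulo
    [i ^ 2 = -1] and [m (x ^ 2 + y ^ 2 + z ^ 2) = 1]. *)
Lemma weierstrass_inversion (psi : R * R -> 'cV[R[i]]_2)
    (r : R * R -> 'rV[R]_3) :
  weierstrass D psi r -> (forall p, D p -> r p != 0) ->
  weierstrass D (fun p => col 0 (spinor_mx (psi p) *m su2mx (inversion (r p))))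
    (fun p => inversion (r p)).
Proof.
move=> [sr dr] r0.
pose N p := r p 0 0 ^+ 2 + r p 0 1 ^+ 2 + r p 0 2 ^+ 2.
have N0 p : D p -> N p != 0.
  by move=> Dp; have := r0 p Dp; rewrite -sqr_norm_eq0 sum3.
have sN : smooth D N.
  have sr2 k : smooth D (fun p => r p 0 k ^+ 2).
    apply: (smooth_eq_on oD _ (smoothM oD (sr k) (sr k))) => p _.
    by rewrite expr2.
  by apply: smoothD => //; exact: smoothD.
have sm : smooth D (fun p => (N p)^-1) := smoothV oD N0 sN.
split=> [k|p Dp].
  apply: (smooth_eq_on oD _ (smoothN oD (smoothM oD sm (sr k)))) => p _.
  by rewrite inversionE.
have [dx dy dz] := dr p Dp.
have cM := csmooth_real sm; have cX k := csmooth_real (sr k).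
have cMX k := csmoothM oD cM (cX k).
have rtE k : (fun q => (inversion (r q) 0 k)%:C) =
    fun q => - (((N q)^-1)%:C * (r q 0 k)%:C).
  by apply/funext => q; rewrite inversionE real_complexN real_complexM.
have drt k : del (fun q => (inversion (r q) 0 k)%:C) p =
    - (del (fun q => ((N q)^-1)%:C) p * (r p 0 k)%:C +
       ((N p)^-1)%:C * del (fun q => (r q 0 k)%:C) p).
  by rewrite rtE (delN (cMX k) Dp) (delM cM (cX k) Dp).
have cN := csmooth_real sN.
have NE : (fun q => (N q)%:C) = fun q =>
    (r q 0 0)%:C * (r q 0 0)%:C + (r q 0 1)%:C * (r q 0 1)%:C +
    (r q 0 2)%:C * (r q 0 2)%:C.
  by apply/funext => q; rewrite /N !expr2 !real_complexD !real_complexM.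
have dN : del (fun q => (N q)%:C) p =
    2 * ((r p 0 0)%:C * del (fun q => (r q 0 0)%:C) p +
         (r p 0 1)%:C * del (fun q => (r q 0 1)%:C) p +
         (r p 0 2)%:C * del (fun q => (r q 0 2)%:C) p).
  have cXX k := csmoothM oD (cX k) (cX k).
  rewrite NE (delD (csmoothD oD (cXX 0) (cXX 1)) (cXX 2) Dp).
  rewrite (delD (cXX 0) (cXX 1) Dp) !(delM (cX _) (cX _) Dp).
  move: (del _ p) (del _ p) (del _ p) => d0 d1 d2.
  by move: (r p 0 0)%:C (r p 0 1)%:C (r p 0 2)%:C => x y z; ring.
have mn : ((N p)^-1)%:C * (N p)%:C = 1 :> R[i].
  by rewrite -real_complexM mulVf ?N0 // (rmorph1 (real_complex R)).
have dM : del (fun q => ((N q)^-1)%:C) p =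
    - (((N p)^-1)%:C * ((N p)^-1)%:C * del (fun q => (N q)%:C) p).
  have : del (fun q => ((N q)^-1)%:C * (N q)%:C) p = 0.
    rewrite -(del_cst 1 p); apply: (del_eq_on oD) => // q /set_mem Dq.
    by rewrite -real_complexM mulVf ?N0 // (rmorph1 (real_complex R)).
  rewrite (delM cM cN Dp) => /eqP; rewrite addr_eq0 => /eqP d.
  by rewrite -[LHS]mulr1 -mn mulrCA d mulrN mulrA.
rewrite (congr1 (@^~ p) NE) in mn.
(* m N = 1, solved for one monomial so that it can serve as a rewriting rule. *)
have mn' : ((N p)^-1)%:C * ((r p 0 0)%:C * (r p 0 0)%:C) =
    1 - ((N p)^-1)%:C * ((r p 0 1)%:C * (r p 0 1)%:C + (r p 0 2)%:C * (r p 0 2)%:C).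
  by rewrite -mn; ring.
move=> p1 p2.
have p1E : p1 = psi p 0 0 * ('i%C * - (((N p)^-1)%:C * (r p 0 2)%:C)) -
    (psi p 1 0)^*%C * (- (((N p)^-1)%:C * (r p 0 0)%:C) -
                       'i%C * - (((N p)^-1)%:C * (r p 0 1)%:C)).
  by rewrite /p1 col_spinor_su2 !inversionE !real_complexN !real_complexM.
have p2E : p2^*%C = (psi p 1 0)^*%C * ('i%C * (((N p)^-1)%:C * (r p 0 2)%:C)) +
    psi p 0 0 * (- (((N p)^-1)%:C * (r p 0 0)%:C) +
                       'i%C * - (((N p)^-1)%:C * (r p 0 1)%:C)).
  rewrite /p2 col_spinor_su2 !inversionE !real_complexN !real_complexM.
  rewrite !(conjcD, conjcM, conjcN, conjcB, conjcK, conjc_real, conjc_imaginary).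
  by rewrite !mulrNN [in RHS]mulrN.
have ii := @imaginary_sqr R.
rewrite !drt dM dN dx dy dz p1E p2E; clear -mn' ii.
move: (psi p 0 0) (psi p 1 0)^*%C mn' => a b.
move: ((N p)^-1)%:C (r p 0 0)%:C (r p 0 1)%:C (r p 0 2)%:C => m x y z.
move: 'i%C ii => j jj mn'.
by split; field: jj mn'.
Qed.

End InvertedSurface.
(** * The Dirac equation for the transformed spinor *)

(** For a matrix with equal off-diagonal entries, the correction to the potential
    is the scalar matrix of this entry. *)
Lemma offdiagonal_scalar (K : comPzRingType) (u c s : K) (H : 'M[K]_2) :
  H 0 1 = s -> H 1 0 = s ->
  (u - c * s)%:M = u%:M - c *: (mx2 0 1 0 0 *m H *m mx2 1 0 0 0 +
                                mx2 0 0 1 0 *m H *m mx2 0 0 0 1).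
Proof.
move=> H01 H10.
have eE (A B C : 'M[K]_2) i j :
  (A - c *: (B + C)) i j = A i j - c * (B i j + C i j) by rewrite !mxE.
have scE (a : K) : a%:M = mx2 a 0 0 a by apply: mx2P; rewrite !mx2E !mxE.
rewrite !scE; apply: mx2P; rewrite eE !mulmx2 !mx2E ?H01 ?H10;
  by rewrite !(mul0r, mulr0, mul1r, mulr1, add0r, addr0, subr0, oppr0).
Qed.

Section Dirac.
Context {R : realType} (D : set (R * R)).
Hypothesis oD : open D.

Lemma dirac_opP (U : R * R -> R) n (Psi : R * R -> 'M[R[i]]_(2, n)) p :
  dirac_op U Psi p = 0 <->
  forall j, del (fun q => Psi q 1 j) p = - ((U p)%:C * Psi p 0 j) /\
            delbar (fun q => Psi q 0 j) p = (U p)%:C * Psi p 1 j.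
Proof.
split=> [E j|E].
  have := congr1 (fun A : 'M[R[i]]_(2, n) => A 1 j) E.
  have := congr1 (fun A : 'M[R[i]]_(2, n) => A 0 j) E.
  rewrite !mxE /= => /eqP; rewrite addr_eq0 => /eqP -> /eqP.
  by rewrite addrC subr_eq0 => /eqP ->.
apply/matrixP => i j; have [E1 E2] := E j; rewrite !mxE.
case: i => -[|[|//]] lt2.
  by rewrite (_ : Ordinal lt2 = 0) /= ?E1 ?addNr //; exact/val_inj.
by rewrite (_ : Ordinal lt2 = 1) /= ?E2 ?addNr //; exact/val_inj.
Qed.

(** The second column of [spinor_mx phi] solves the equation with [phi]:
    conjugating the two equations exchanges them, as the
    potential is real. *)
Lemma dirac_spinor_mx (U : R * R -> R) (phi : R * R -> 'cV[R[i]]_2) p :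
  mxsmooth D phi -> D p -> dirac_op U phi p = 0 ->
  dirac_op U (fun q => spinor_mx (phi q)) p = 0.
Proof.
move=> sphi Dp /dirac_opP/(_ 0)[E1 E2]; have [s0 s1] := (sphi 0 0, sphi 1 0).
have eta (A : R * R -> R[i]) B : (forall q, A q = B q) -> A = B by move/funext.
apply/dirac_opP => j.
have [->|->] : j = 0 \/ j = 1.
  by case: j => -[|[|//]] lt2; [left|right]; exact/val_inj.
- rewrite (eta (fun q => spinor_mx (phi q) 1 0) (fun q => phi q 1 0)); last first.
    by move=> q; rewrite mx2E.
  rewrite (eta (fun q => spinor_mx (phi q) 0 0) (fun q => phi q 0 0)); last first.
    by move=> q; rewrite mx2E.
  by rewrite E1 E2 !mx2E.
rewrite (eta (fun q => spinor_mx (phi q) 1 1) (fun q => (phi q 0 0)^*%C)); last first.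
  by move=> q; rewrite mx2E.
rewrite (eta (fun q => spinor_mx (phi q) 0 1) (fun q => - (phi q 1 0)^*%C)); last first.
  by move=> q; rewrite mx2E.
rewrite !mx2E (del_conj oD s0 Dp) E2 conjcM conjc_real.
split; first by rewrite mulrN opprK.
rewrite (delbar_conj (csmoothN oD (csmooth_conj oD s1)) Dp).
rewrite (eta (fun q => (- (phi q 1 0)^*%C)^*%C) (fun q => - phi q 1 0)); last first.
  by move=> q; rewrite conjcN conjcK.
by rewrite (delN s1 Dp) E1 opprK conjcM conjc_real.
Qed.

Lemma mxsmooth_spinor_mx (phi : R * R -> 'cV[R[i]]_2) :
  mxsmooth D phi -> mxsmooth D (fun q => spinor_mx (phi q)).
Proof.
move=> sphi i j; have [s0 s1] := (sphi 0 0, sphi 1 0).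
apply: (csmooth_eq_on oD (f := fun p =>
  if i == 0 then (if j == 0 then phi p 0 0 else - (phi p 1 0)^*%C)
  else (if j == 0 then phi p 1 0 else (phi p 0 0)^*%C))).
  by move=> p _; rewrite mxE.
case: (i == 0); case: (j == 0) => //.
  by apply: csmoothN => //; exact: csmooth_conj.
exact: csmooth_conj.
Qed.

Lemma mxsmooth_col_spinor_su2 (psi : R * R -> 'cV[R[i]]_2)
    (x : R * R -> 'rV[R]_3) :
  mxsmooth D psi -> (forall k, smooth D (fun p => x p 0 k)) ->
  mxsmooth D (fun p => col 0 (spinor_mx (psi p) *m su2mx (x p))).
Proof.
move=> spsi sx.
have c k := csmooth_real (sx k).
have [s0 s1] := (spsi 0 0, spsi 1 0).
have [c0 c1] := (csmooth_conj oD s0, csmooth_conj oD s1).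
have ci : csmooth D (fun=> 'i%C) by exact: csmooth_cst.
have ciz := csmoothM oD ci (c 2).
have cxy := csmoothD oD (c 0) (csmoothN oD (csmoothM oD ci (c 1))).
move=> i j; rewrite ord1.
case: i => -[|[|//]] lt2.
- apply: (csmooth_eq_on oD _
    (csmoothD oD (csmoothM oD s0 ciz) (csmoothN oD (csmoothM oD c1 cxy)))).
  by move=> p _; rewrite (_ : Ordinal lt2 = 0) ?col_spinor_su2 //; exact/val_inj.
- apply: (csmooth_eq_on oD _
    (csmoothD oD (csmoothM oD s1 ciz) (csmoothM oD c0 cxy))).
  by move=> p _; rewrite (_ : Ordinal lt2 = 1) ?col_spinor_su2 //; exact/val_inj.
Qed.

Section Potential.
Variables (U : R * R -> R) (psi : R * R -> 'cV[R[i]]_2) (x : R * R -> 'rV[R]_3).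
Let phi p := col 0 (spinor_mx (psi p) *m su2mx (x p)).
Hypothesis spsi : mxsmooth D psi.
Hypothesis dpsi : forall p, D p -> dirac_op U psi p = 0.
Hypothesis wx : weierstrass D phi x.

(** The entry [G_01] of the matrix [Phi Gamma Psi0^T], which is also [G_10]
    ([potential_shift_Gamma]). *)
Definition potential_shift p : R[i] :=
  phi p 0 0 * (psi p 0 0)^*%C + (phi p 1 0)^*%C * psi p 1 0.

(** The shift is the value at a vector built from [psi] of the sesquilinear form
    of the anti-Hermitian matrix [su2mx x], hence imaginary. *)
Lemma conj_potential_shift p : (potential_shift p)^*%C = - potential_shift p.
Proof.
rewrite /potential_shift !col_spinor_su2.
rewrite !(conjcD, conjcM, conjcN, conjcB, conjcK, conjc_real, conjc_imaginary).
move: (psi p 0 0) (psi p 1 0) => a b; move: (a^*%C) (b^*%C) => a' b'.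
move: (x p 0 0)%:C (x p 0 1)%:C (x p 0 2)%:C 'i%C => X Y Z j; ring.
Qed.

Lemma imaginary_potential_shift p :
  (complex.Im (potential_shift p))%:C = - 'i%C * potential_shift p.
Proof.
have := conj_potential_shift p; case: (potential_shift p) => a b /= -[].
by move=> /eqP; rewrite -addr_eq0 -mulr2n mulrn_eq0 /= => /eqP ->;
  apply/eqP; rewrite eq_complex /=; apply/andP; split; apply/eqP; ring.
Qed.

(** Differentiate the product that defines [phi].  The Weierstrass formulas for
    the derivatives of [x] are quadratic in [phi] itself; in the first equation
    the terms that they produce have the common factor [phi 0], in the conjugate
    of the second one [conj (phi 1)], and the cofactor is the shift of the
    potential. *)
Lemma dirac_potential p : D p ->
  dirac_op (fun p => U p + complex.Im (potential_shift p)) phi p = 0.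
Proof.
move=> Dp; apply/dirac_opP => j; rewrite (ord1 j).
have [s0 s1] := (spsi 0 0, spsi 1 0).
have [c0 c1] := (csmooth_conj oD s0, csmooth_conj oD s1).
have c k := csmooth_real (wx.1 k).
have sphi := mxsmooth_col_spinor_su2 spsi wx.1.
have ci : csmooth D (fun=> 'i%C : R[i]) by exact: csmooth_cst.
have ciz := csmoothM oD ci (c 2); have ciy := csmoothM oD ci (c 1).
have cxy := csmoothD oD (c 0) (csmoothN oD ciy).
have cxy' := csmoothD oD (c 0) ciy.
have /dirac_opP/(_ 0)[E1 E2] := dpsi Dp.
have Ec : del (fun q => (psi q 0 0)^*%C) p = (U p)%:C * (psi p 1 0)^*%C.
  by rewrite (del_conj oD s0 Dp) E2 conjcM conjc_real.
have [dx dy dz] := wx.2 p Dp.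
have diz := delM ci (c 2) Dp; have diy := delM ci (c 1) Dp.
have dxy := delD (c 0) (csmoothN oD ciy) Dp.
have dxy' := delD (c 0) ciy Dp.
rewrite (delN ciy Dp) in dxy.
rewrite !del_cst !mul0r !add0r in diz diy.
have ii := @imaginary_sqr R.
have UE : (U p + complex.Im (potential_shift p))%:C =
    (U p)%:C - 'i%C * potential_shift p.
  by rewrite real_complexD imaginary_potential_shift mulNr.
(* The definitions of phi 0 and of the conjugate of phi 1, solved for the term
   in x 2 so that they can serve as rewriting rules. *)
have PE : psi p 0 0 * ('i%C * (x p 0 2)%:C) =
    phi p 0 0 + (psi p 1 0)^*%C * ((x p 0 0)%:C - 'i%C * (x p 0 1)%:C).
  by rewrite /phi col_spinor_su2 subrK.
have QE : (psi p 1 0)^*%C * ('i%C * (x p 0 2)%:C) =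
    psi p 0 0 * ((x p 0 0)%:C + 'i%C * (x p 0 1)%:C) - (phi p 1 0)^*%C.
  rewrite /phi col_spinor_su2.
  rewrite !(conjcD, conjcM, conjcN, conjcB, conjcK, conjc_real, conjc_imaginary).
  by rewrite !mulNr mulrN !opprK opprD opprK addrCA subrr addr0.
split.
  rewrite (_ : (fun q => phi q 1 0) = fun q =>
    psi q 1 0 * ('i%C * (x q 0 2)%:C) +
    (psi q 0 0)^*%C * ((x q 0 0)%:C - 'i%C * (x q 0 1)%:C)); last first.
    by apply/funext => q; rewrite /phi col_spinor_su2.
  rewrite (delD (csmoothM oD s1 ciz) (csmoothM oD c0 cxy) Dp).
  rewrite (delM s1 ciz Dp) (delM c0 cxy Dp) diz dxy diy dx dy dz E1 Ec UE.
  rewrite /potential_shift; clear -PE ii.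
  move: (phi p 0 0) (phi p 1 0)^*%C PE => P Q.
  move: (psi p 0 0) (psi p 1 0) => a b; move: a^*%C b^*%C => a' b'.
  move: (U p)%:C (x p 0 0)%:C (x p 0 1)%:C (x p 0 2)%:C => u X Y Z.
  move: 'i%C ii => j jj PE.
  by field: jj PE.
have cUE : ((U p + complex.Im (potential_shift p))%:C * phi p 1 0)^*%C =
    ((U p)%:C - 'i%C * potential_shift p) * (phi p 1 0)^*%C.
  by rewrite conjcM conjc_real UE.
rewrite (delbar_conj (sphi 0 0) Dp) -[RHS]conjcK cUE; congr (_^*%C).
rewrite (_ : (fun q => (phi q 0 0)^*%C) = fun q =>
  - ((psi q 0 0)^*%C * ('i%C * (x q 0 2)%:C)) -
    psi q 1 0 * ((x q 0 0)%:C + 'i%C * (x q 0 1)%:C)); last first.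
  apply/funext => q; rewrite /phi col_spinor_su2.
  rewrite !(conjcD, conjcM, conjcN, conjcB, conjcK, conjc_real, conjc_imaginary).
  by rewrite !mulNr mulrN opprK.
have t1 := csmoothM oD c0 ciz; have t2 := csmoothM oD s1 cxy'.
rewrite (delD (csmoothN oD t1) (csmoothN oD t2) Dp) (delN t1 Dp) (delN t2 Dp).
rewrite (delM c0 ciz Dp) (delM s1 cxy' Dp) diz dxy' diy dx dy dz E1 Ec.
rewrite /potential_shift; clear -QE ii.
move: (phi p 0 0) (phi p 1 0)^*%C QE => P Q.
move: (psi p 0 0) (psi p 1 0) => a b; move: a^*%C b^*%C => a' b'.
move: (U p)%:C (x p 0 0)%:C (x p 0 1)%:C (x p 0 2)%:C => u X Y Z.
move: 'i%C ii => j jj QE.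
by field: jj QE.
Qed.

Lemma potential_shift_Gamma p :
  let H := spinor_mx (phi p) *m Gamma R *m (spinor_mx (psi p))^T in
  H 0 1 = potential_shift p /\ H 1 0 = potential_shift p.
Proof.
have tE (A : 'M[R[i]]_2) i j : A^T i j = A j i by rewrite mxE.
split; last rewrite -[RHS]opprK -conj_potential_shift /potential_shift.
  rewrite !mulmx2 /Gamma !tE !mx2E /potential_shift.
  by move: (phi p 0 0) (phi p 1 0)^*%C (psi p 1 0) (psi p 0 0)^*%C => a b c d; ring.
rewrite !mulmx2 /Gamma !tE !mx2E conjcD !conjcM !conjcK.
by move: (phi p 0 0)^*%C (phi p 1 0) (psi p 1 0)^*%C (psi p 0 0) => a b c d; ring.
Qed.

End Potential.
End Dirac.
Theorem theorem1 (R : realType) (D : set (R * R)) (U : R * R -> R)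
    (psi : R * R -> 'cV[R[i]]_2) (P0 : R * R) (r : R * R -> 'rV[R]_3) :
  let S : R * R -> 'M[R[i]]_2 := fun p => su2mx (r p) in
  let Psi0 : R * R -> 'M[R[i]]_2 := fun p => spinor_mx (psi p) in
  let Psi0t : R * R -> 'M[R[i]]_2 := fun p => Psi0 p *m invmx (S p) in
  let rt : R * R -> 'rV[R]_3 := fun p => inversion (r p) in
  let G : R * R -> 'M[R[i]]_2 :=
    fun p => Psi0 p *m invmx (S p) *m Gamma R *m (Psi0 p)^T in
  simply_connected_domain D ->
  smooth D U ->
  mxsmooth D psi ->
  (forall p, D p -> dirac_op U psi p = 0) ->
  (forall p, D p -> psi p != 0) ->
  D P0 ->
  (forall P c, contour D P0 P c ->
     S P = S P0 + 'i%C *: line_integral (fun p => weierstrass_dz (psi p))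
                                        (fun p => weierstrass_dzbar (psi p)) c) ->
  (forall p, D p -> S p != 0) ->
  [/\ forall p, D p -> su2mx (rt p) = invmx (S p),
      weierstrass D (fun p => col 0 (Psi0t p)) rt &
      exists Ut : R * R -> R,
        [/\ smooth D Ut,
            forall p, D p ->
              ((Ut p)%:C)%:M
              = ((U p)%:C)%:M
                - 'i%C *: (mx2 0 1 0 0 *m G p *m mx2 1 0 0 0
                           + mx2 0 0 1 0 *m G p *m mx2 0 0 0 1)
                :> 'M[R[i]]_2,
            mxsmooth D Psi0t &
            forall p, D p -> dirac_op Ut Psi0t p = 0]].
Proof.
move=> S Psi0 Psi0t rt G [oD cD _] sU spsi dpsi psi0 DP0 SE S0.
have wr := weierstrass_of_integral oD cD spsi DP0 SE.
have r0 p : D p -> r p != 0.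
  by move=> /S0; apply: contra => /eqP r0; rewrite /S r0 su2mx0.
pose phi p := col 0 (spinor_mx (psi p) *m su2mx (rt p)).
have Psi0tE : Psi0t = fun p => spinor_mx (phi p).
  by apply/funext => p; rewrite /Psi0t /S invmx_su2mx spinor_mx_su2mx.
have phiE : (fun p => col 0 (Psi0t p)) = phi.
  by apply/funext => p; rewrite /Psi0t /S invmx_su2mx.
have wrt : weierstrass D phi rt := weierstrass_inversion oD wr r0.
have sphi : mxsmooth D phi := mxsmooth_col_spinor_su2 oD spsi wrt.1.
split.
- by move=> p _; rewrite /S invmx_su2mx.
- by rewrite phiE.
pose s := potential_shift psi rt.
have ss : csmooth D s.
  have c1 := csmooth_conj oD (sphi 1 0); have c0 := csmooth_conj oD (spsi 0 0).
  exact: (csmoothD oD (csmoothM oD (sphi 0 0) c0) (csmoothM oD c1 (spsi 1 0))).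
exists (fun p => U p + complex.Im (s p)); split.
- exact: (smoothD oD sU ss.2).
- move=> p Dp.
  have GE : G p = spinor_mx (phi p) *m Gamma R *m (spinor_mx (psi p))^T.
    by rewrite /G -/(Psi0t p) Psi0tE.
  have [g01 g10] := potential_shift_Gamma psi rt p; rewrite -GE in g01 g10.
  rewrite real_complexD imaginary_potential_shift mulNr.
  exact: offdiagonal_scalar.
- by rewrite Psi0tE; exact: mxsmooth_spinor_mx.
move=> p Dp; rewrite Psi0tE; apply: (dirac_spinor_mx oD sphi Dp).
exact: (dirac_potential oD spsi dpsi wrt).
Qed.
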